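(* Let $X$ be an arbitrary topological space and let $d_1$ and $d_2$ be two equivalent distances (metrics) on a set $Y$, i.e. metrics inducing the same topology on $Y$. Then $T_{d_1}(X,Y)$ and $T_{d_2}(X,Y)$ are the same topological space; that is, the fine $C^0$-topology on the set $F(X,Y)$ of continuous functions $X\to Y$ defined using $d_1$ coincides with the fine $C^0$-topology on $F(X,Y)$ defined using $d_2$.
   Context: Let $X$ be a topological space and $(Y,d)$ a metric space. $F(X,Y)$ denotes the set of continuous functions from $X$ to $Y$, and $\mathbb{R}^+$ denotes the set of (strictly) positive reals. For $f\in F(X,Y)$ and a continuous function $\delta: X\to\mathbb{R}^+$, a function $g\in F(X,Y)$ is a $\delta$-approximation of $f$ if $d(f(x),g(x))<\delta(x)$ for all $x\in X$. The $\delta$-neighborhood of $f$ is the set of all $\delta$-approximations of $f$. A neighborhood of $f$ is a subset of $F(X,Y)$ that contains the $\delta$-neighborhood of $f$ for some continuous $\delta: X\to\mathbb{R}^+$. These neighborhoods define a topology on $F(X,Y)$, called the fine $C^0$-topology (with respect to $d$); $T_d(X,Y)$ denotes $F(X,Y)$ with this topology. *)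

(* Defs.v *)
From HB Require Import structures.
From mathcomp Require Import all_boot all_order all_algebra.
From mathcomp Require Import all_classical all_reals all_analysis.
From mathcomp Require Import lra.

Set Implicit Arguments.
Unset Strict Implicit.
Unset Printing Implicit Defensive.
Import Order.TTheory GRing.Theory Num.Theory.
Import numFieldNormedType.Exports.
Local Open Scope classical_set_scope.
Local Open Scope ring_scope.

(* The library puts at most one metric on a given carrier. To compare two of
   them, a metric is a first-class value here, with the axioms of [isMetric],
   and [metric_space d] is the copy of [Y] equipped with [d]. *)
Record metric (R : realType) (Y : Type) := {
  dist :> Y -> Y -> R ;
  distxx : forall x, dist x x = 0 ;
  dist_positivity : forall x y, dist x y = 0 -> x = y ;
  dist_sym : forall x y, dist x y = dist y x ;
  dist_triangle : forall y x z, dist x z <= dist x y + dist y z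
}.

Definition metric_space (R : realType) (Y : Type) (d : metric R Y) : Type := Y.

HB.instance Definition _ (R : realType) (Y : Type) (d : metric R Y) :=
  gen_eqMixin (metric_space d).
HB.instance Definition _ (R : realType) (Y : Type) (d : metric R Y) :=
  gen_choiceMixin (metric_space d).
HB.instance Definition _ (R : realType) (Y : Type) (d : metric R Y) :=
  @isMetric.Build R (metric_space d) d (distxx d) (@dist_positivity _ _ d)
    (dist_sym d) (dist_triangle d).

Definition equivalent_metrics (R : realType) (Y : Type) (d1 d2 : metric R Y) :=
  forall A : set Y,
    open (A : set (metric_space d1)) <-> open (A : set (metric_space d2)).

Definition approximations (R : realType) (X : topologicalType)
    (Y : metricType R) (delta : X -> R) (f : continuousType X Y) :
  set (continuousType X Y) := [set g | forall x, mdist (f x) (g x) < delta x].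

Definition fine_C0 (R : realType) (X : topologicalType) (Y : metricType R) :
  Type := continuousType X Y.

Definition fine_C0_nbhs (R : realType) (X : topologicalType)
    (Y : metricType R) (f : fine_C0 X Y) : set_system (fine_C0 X Y) :=
  [set N | exists delta : X -> R,
     [/\ continuous delta, forall x, 0 < delta x & approximations delta f `<=` N]].

Section fine_C0_topology.
Context (R : realType) (X : topologicalType) (Y : metricType R).

HB.instance Definition _ := Choice.copy (fine_C0 X Y) (continuousType X Y).
HB.instance Definition _ := hasNbhs.Build (fine_C0 X Y) (@fine_C0_nbhs R X Y).

Let fine_C0_nbhs_singleton (f : fine_C0 X Y) (N : set (fine_C0 X Y)) :
  nbhs f N -> N f.
Proof. by move=> [delta [_ dpos]]; apply=> x /=; rewrite mdistxx. Qed.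

Let fine_C0_nbhs_filter (f : fine_C0 X Y) : ProperFilter (nbhs f).
Proof.
split; first by move/fine_C0_nbhs_singleton.
split.
- by exists (fun=> 1); split=> // x; exact: cvg_cst.
- move=> P Q [d [dc d0 dP]] [e [ec e0 eQ]].
  exists (fun x => Num.min (d x) (e x)); split.
  + by move=> x; exact: continuous_min (dc x) (ec x).
  + by move=> x; rewrite lt_min d0 e0.
  + by move=> g gde; split; [apply: dP|apply: eQ] => x; move: (gde x);
      rewrite lt_min => /andP[].
- by move=> P Q PQ [d [dc d0 dP]]; exists d; split=> // g /dP /PQ.
Qed.

Let continuous_mdist (f g : fine_C0 X Y) :
  continuous (fun x => mdist ((f : continuousType X Y) x)
                             ((g : continuousType X Y) x)).
Proof.
move=> x; apply/cvgrPdist_lt => e e0.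
have e2 : 0 < e / 2 by rewrite divr_gt0.
have fx := @cts_fun _ _ (f : continuousType X Y) x.
have gx := @cts_fun _ _ (g : continuousType X Y) x.
move/metricType_numDomainType.cvgrPdist_lt : fx => /(_ _ e2) fx.
move/metricType_numDomainType.cvgrPdist_lt : gx => /(_ _ e2) gx.
near=> y.
have fy : mdist ((f : continuousType X Y) x) ((f : continuousType X Y) y) < e / 2.
  by near: y.
have gy : mdist ((g : continuousType X Y) x) ((g : continuousType X Y) y) < e / 2.
  by near: y.
rewrite [e]splitr; apply: le_lt_trans (ltrD fy gy).
set a := (f : continuousType X Y) x; set b := (f : continuousType X Y) y.
set a' := (g : continuousType X Y) x; set b' := (g : continuousType X Y) y.
have t1 := metric_triangle a b a'; have t2 := metric_triangle b b' a'.
have t3 := metric_triangle b a b'; have t4 := metric_triangle a a' b'.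
rewrite ler_norml; rewrite (metric_sym b' a') in t2.
rewrite (metric_sym b a) in t3.
apply/andP; split; lra.
Unshelve. all: by end_near. Qed.

Let fine_C0_nbhs_nbhs (f : fine_C0 X Y) (N : set (fine_C0 X Y)) :
  nbhs f N -> nbhs f (nbhs^~ N).
Proof.
move=> [d [dc d0 dN]]; exists d; split=> // g fgd.
exists (fun x => d x - mdist ((f : continuousType X Y) x)
                             ((g : continuousType X Y) x)); split.
- by move=> x; apply: cvgB; [exact: dc|exact: continuous_mdist].
- by move=> x; rewrite subr_gt0; exact: fgd.
- move=> h gh; apply: dN => x /=.
  apply: le_lt_trans (metric_triangle _ ((g : continuousType X Y) x) _) _.
  by rewrite addrC -ltrBrDr; exact: gh.
Qed.

HB.instance Definition _ := Nbhs_isNbhsTopological.Build (fine_C0 X Y)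
  fine_C0_nbhs_filter fine_C0_nbhs_singleton fine_C0_nbhs_nbhs.

End fine_C0_topology.

(* [T_d1(X,Y)] and [T_d2(X,Y)] have different types, because continuity is
   relative to the metric; they are compared as sets of maps [X -> Y], each
   with its family of open subsets. *)
Definition fine_C0_carrier (R : realType) (X : topologicalType) (Y : Type)
    (d : metric R Y) : set (X -> Y) :=
  [set f | continuous (f : X -> metric_space d)].

Definition fine_C0_opens (R : realType) (X : topologicalType) (Y : Type)
    (d : metric R Y) : set (set (X -> Y)) :=
  [set A | exists2 U : set (fine_C0 X (metric_space d)),
     open U & A = @Continuous.sort X (metric_space d) @` U].

Arguments fine_C0_carrier {R} X {Y} d _.
Arguments fine_C0_opens {R} X {Y} d _.

(* Main.v *)
Require Import Defs.
From mathcomp Require Import all_boot all_order all_algebra.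
From mathcomp Require Import all_classical all_reals all_analysis.
From mathcomp Require Import lra.

(** Given [delta] for the distance [d'], the idea is to produce a continuous
    positive [eta] such that [d (f x) z < eta x] forces [d' (f x) z < delta x].
    Take [eta x := gauge (f x) (delta x)], where
    [gauge y e := inf_z (d y z + max(0, e - d' y z))]. If [d' y z >= e] then the
    term of index [z] is [d y z], whence [gauge y e <= d y z]. As an infimum of
    functions that are uniformly Lipschitz, [gauge] is Lipschitz for
    [d + d'] in [y] and for the usual distance in [e], so [eta] is
    continuous; it is positive because a small [d]-ball lies in the [d']-ball of
    radius [e / 2]. *)

Set Implicit Arguments.
Unset Strict Implicit.
Unset Printing Implicit Defensive.
Import Order.TTheory GRing.Theory Num.Theory.
Import numFieldNormedType.Exports.
Local Open Scope classical_set_scope.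
Local Open Scope ring_scope.

Lemma equivalent_metrics_sym (R : realType) (Y : Type) (d d' : metric R Y) :
  equivalent_metrics d d' -> equivalent_metrics d' d.
Proof. by move=> dd' A; split=> /dd'. Qed.

Lemma metric_ge0 (R : realType) (Y : Type) (d : metric R Y) (y z : Y) :
  0 <= d y z.
Proof. exact: (@mdist_ge0 _ (metric_space d) y z). Qed.

Section gauge.
Context (R : realType) (Y : Type) (d d' : metric R Y).

Definition gauge (y : Y) (e : R) : R :=
  inf (range (fun z => d y z + Num.max 0 (e - d' y z))).

Lemma gauge_le (y z : Y) (e : R) :
  gauge y e <= d y z + Num.max 0 (e - d' y z).
Proof.
apply: ge_inf; last by exists z.
exists 0 => _ [w _ <-]; apply: addr_ge0; first exact: metric_ge0.
by rewrite le_max lexx.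
Qed.

Lemma le_gauge (y : Y) (e c : R) :
  (forall z, c <= d y z + Num.max 0 (e - d' y z)) -> c <= gauge y e.
Proof.
move=> cle; apply: lb_le_inf; first by eexists; exists y.
by move=> _ [z _ <-].
Qed.

Lemma lt_gauge (y z : Y) (e : R) : d y z < gauge y e -> d' y z < e.
Proof.
move=> /lt_le_trans/(_ (gauge_le y z e)); rewrite ltrDl lt_max ltxx /=.
by rewrite subr_gt0.
Qed.

(** For fixed [z], the triangle inequalities and the 1-Lipschitz map [Num.max 0] bound the change of
    the term of index [z] independently of [z], so the bound passes to the infimum. *)
Lemma gauge_lip_le (y y' : Y) (e e' : R) :
  gauge y e <= gauge y' e' + (d y y' + d' y y' + `|e - e'|).
Proof.
rewrite -lerBlDr; apply: le_gauge => z; rewrite lerBlDr.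
apply: le_trans (gauge_le y z e) _.
have := dist_triangle d y' y z; have := dist_triangle d' y y' z.
rewrite (dist_sym d' y' y); have := ler_norm (e - e').
have := metric_ge0 d' y y'; have := normr_ge0 (e - e').
rewrite /Num.max; case: (ltP 0 (e - _)); case: (ltP 0 (e' - _)); lra.
Qed.

End gauge.

Section equivalent.
Context (R : realType) (Y : Type) (d d' : metric R Y).
Context (dd' : equivalent_metrics d d').

Lemma gauge_gt0 (y : Y) (e : R) : 0 < e -> 0 < gauge d d' y e.
Proof.
move=> e0; have e2 : 0 < e / 2 by rewrite divr_gt0.
have : nbhs (y : metric_space d') (ball (y : metric_space d') (e / 2)).
  exact: nbhsx_ballx.
(* Equivalence of the metrics enters here: the [d']-open set [A] inside the ball is also [d]-open,
   so it contains a [d]-ball around [y]. *)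
rewrite nbhsE => -[A [/dd' Ao Ay] Ae].
have : nbhs (y : metric_space d) (A : set (metric_space d)).
  exact: open_nbhs_nbhs.
move=> /nbhs_ballP[r /= r0 rA].
(* A bound uniform in [z] keeps the infimum positive: far from [y] the summand [d y z] is at least
   [r]; within [d]-distance [r] the summand [e - d' y z] exceeds [e / 2]. *)
apply: (@lt_le_trans _ _ (Num.min r (e / 2))); first by rewrite lt_min r0.
apply: le_gauge => z; rewrite ge_min.
have m0 : 0 <= Num.max 0 (e - d' y z) by rewrite le_max lexx.
have [rz|zr] := leP r (d y z); first by rewrite (le_trans rz)// lerDl.
have dz : d' y z < e / 2.
  have : ball (y : metric_space d') (e / 2) z.
    by apply/Ae/rA; rewrite ballEmdist.
  by rewrite ballEmdist.
have m1 : e - d' y z <= Num.max 0 (e - d' y z) by rewrite le_max lexx orbT.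
by apply/orP; right; move: (metric_ge0 d y z); lra.
Qed.

Context (X : topologicalType).

Lemma equivalent_metrics_continuous (f : X -> Y) :
  continuous (f : X -> metric_space d) -> continuous (f : X -> metric_space d').
Proof. by move=> /continuousP fc; apply/continuousP => A /dd' /fc. Qed.

Lemma continuous_gauge (f : X -> Y) (delta : X -> R) :
  continuous (f : X -> metric_space d) -> continuous delta ->
  continuous (fun x => gauge d d' (f x) (delta x)).
Proof.
move=> fc dc x; have /(_ x) fx' := equivalent_metrics_continuous fc.
have fx := fc x; apply/cvgrPdist_lt => e e0.
(* One third for each summand of the Lipschitz bound. *)
have e3 : 0 < e / 3 by rewrite divr_gt0.
move/metricType_numDomainType.cvgrPdist_lt : fx => /(_ _ e3) fx.
move/metricType_numDomainType.cvgrPdist_lt : fx' => /(_ _ e3) fx'.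
have /cvgrPdist_lt/(_ _ e3) dx := dc x.
near=> t.
have h1 : d (f x) (f t) < e / 3 by near: t.
have h2 : d' (f x) (f t) < e / 3 by near: t.
have h3 : `|delta x - delta t| < e / 3 by near: t.
have := gauge_lip_le d d' (f x) (f t) (delta x) (delta t).
have := gauge_lip_le d d' (f t) (f x) (delta t) (delta x).
rewrite (distrC (delta t)) (dist_sym d (f t)) (dist_sym d' (f t)) ltr_norml.
by move=> ? ?; apply/andP; split; lra.
Unshelve. all: by end_near. Qed.

Lemma fine_C0_carrier_subset : fine_C0_carrier X d `<=` fine_C0_carrier X d'.
Proof. by move=> f; exact: equivalent_metrics_continuous. Qed.

End equivalent.

Lemma fine_C0_opens_subset (R : realType) (X : topologicalType) (Y : Type)
    (d d' : metric R Y) : equivalent_metrics d d' ->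
  fine_C0_opens X d' `<=` fine_C0_opens X d.
Proof.
move=> dd' _ [U Uo ->].
have d'd := equivalent_metrics_sym dd'.
(* [to] and [from] keep the underlying map and change only the metric for which its continuity is
   recorded. *)
pose to (f : continuousType X (metric_space d')) :
    continuousType X (metric_space d) :=
  mkcts (equivalent_metrics_continuous d'd (@cts_fun _ _ f)).
pose from (f : continuousType X (metric_space d)) :
    continuousType X (metric_space d') :=
  mkcts (equivalent_metrics_continuous dd' (@cts_fun _ _ f)).
exists [set g | U (from g)]; last first.
  apply/seteqP; split=> [_ [f Uf <-]|_ [g Ug <-]]; last by exists (from g).
  exists (to f) => //=.
  suff -> : from (to f) = f by [].
  exact/continuousEP.
(* Openness for [d] is checked at each [g]: the gauge turns a [delta] for [d'] at [from g] into a
   radius for [d] at [g]. *)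
rewrite openE => g Ug.
move: Uo; rewrite openE => /(_ _ Ug)[delta [dc d0 dU]].
exists (fun x => gauge d d' (g x) (delta x)); split.
- exact: (continuous_gauge dd' (@cts_fun _ _ g) dc).
- by move=> x; exact: (gauge_gt0 dd').
- by move=> h gh; apply: dU => x; exact: lt_gauge (gh x).
Qed.

Theorem theorem1 (R : realType) (X : topologicalType) (Y : Type)
    (d1 d2 : metric R Y) (d12 : equivalent_metrics d1 d2) :
  fine_C0_carrier X d1 = fine_C0_carrier X d2 /\
  fine_C0_opens X d1 = fine_C0_opens X d2.
Proof.
have d21 := equivalent_metrics_sym d12.
by split; apply/seteqP; split;
  [exact: fine_C0_carrier_subset|exact: fine_C0_carrier_subset
  |exact: fine_C0_opens_subset|exact: fine_C0_opens_subset].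
Qed.
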